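(* Let $f:[0,\infty)\to[0,\infty)$ be a $C^1$ function such that $f(0)=f'(0)=0$. Assume that $f$ is of class $C^3$ in $(0,\infty)$ with $f''>0$ and $f'''\le0$ on $(0,\infty)$, and that $\lim_{s\to\infty}f(s)/s=+\infty$. Consider the convex body of revolution in $\mathbb{R}^{n+1}$ $$C_f=\{(z,t)\in\mathbb{R}^n\times\mathbb{R}:t\ge f(|z|)\}.$$ Then for all $r>0$, $$|B(0,r)\cap C_f|=\inf_{x\in C_f}|B(x,r)\cap C_f|.$$
   Context: Here $n\ge1$, $|E|$ denotes Lebesgue measure in $\mathbb{R}^{n+1}$ and $B(x,r)$ the open Euclidean ball of centre $x$ and radius $r$; $0$ is the origin of $\mathbb{R}^{n+1}$. *)

(* Defs.v *)
From HB Require Import structures.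
From mathcomp Require Import all_boot all_order all_algebra.
From mathcomp Require Import all_classical all_reals all_analysis.
Set Implicit Arguments.
Unset Strict Implicit.
Unset Printing Implicit Defensive.
Import Order.TTheory GRing.Theory Num.Theory.
Import numFieldNormedType.Exports.
Local Open Scope classical_set_scope.
Local Open Scope ring_scope.

Section lebesgue_measure_tuple.
Context {R : realType}.
Notation RR := (measurableTypeR R).

Definition tuple_cons n (x : RR * n.-tuple RR) : n.+1.-tuple RR :=
  [tuple of x.1 :: x.2].

Definition tuple_uncons n (t : n.+1.-tuple RR) : RR * n.-tuple RR :=
  (thead t, [tuple of behead t]).

Lemma tuple_unconsK n : cancel (@tuple_uncons n) (@tuple_cons n).
Proof. by move=> t; rewrite /tuple_cons/= -tuple_eta. Qed.

Lemma tuple_consK n : cancel (@tuple_cons n) (@tuple_uncons n).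
Proof. by move=> [x t]; congr pair; apply/val_inj. Qed.

Lemma measurable_tuple_cons n : measurable_fun setT (@tuple_cons n).
Proof. exact: (measurable_cons measurable_fst measurable_snd). Qed.

Lemma measurable_tuple_uncons n : measurable_fun setT (@tuple_uncons n).
Proof.
by apply: measurable_fun_pair; [exact: measurable_tnth|exact: measurable_behead].
Qed.

Section successor.
Context n (m : {sigma_finite_measure set (n.-tuple RR) -> \bar R}).

Definition lebesgue_tuple_succ : set (n.+1.-tuple RR) -> \bar R :=
  pushforward (@lebesgue_measure R \x m)%E (@tuple_cons n).

HB.instance Definition _ := Measure.copy lebesgue_tuple_succ
  (measure_function_pushforward__canonical__measure_function_Measure
     (@lebesgue_measure R \x m)%E (@measurable_tuple_cons n)).

Let lebesgue_tuple_succ_sigma_finite : sigma_finite setT lebesgue_tuple_succ.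
Proof.
have /sigma_finiteP[F [TF ndF Foo]] := sigma_finiteT (@lebesgue_measure R).
have /sigma_finiteP[G [TG ndG Goo]] := sigma_finiteT m.
exists (fun k => @tuple_uncons n @^-1` (F k `*` G k)).
  rewrite -preimage_bigcup predeqE => t; split=> // _ /=.
  have [k1 _ Fk1] : (\bigcup_k F k) (thead t) by rewrite -TF.
  have [k2 _ Gk2] : (\bigcup_k G k) [tuple of behead t] by rewrite -TG.
  exists (maxn k1 k2) => //; split => /=.
  - by move: (thead t) Fk1; exact/subsetPset/ndF/leq_maxl.
  - by move: [tuple of _] Gk2; exact/subsetPset/ndG/leq_maxr.
move=> k; have [mF Fk] := Foo k; have [mG Gk] := Goo k; split.
  rewrite -[X in measurable X]setTI.
  by apply: measurable_tuple_uncons => //; exact: measurableX.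
rewrite /lebesgue_tuple_succ /pushforward -comp_preimage.
rewrite (_ : _ \o _ = id); last by apply/funext => x; exact: tuple_consK.
by rewrite preimage_id product_measure1E// lte_mul_pinfty// ge0_fin_numE.
Qed.

HB.instance Definition _ := @Measure_isSigmaFinite.Build _ _ _
  lebesgue_tuple_succ lebesgue_tuple_succ_sigma_finite.

End successor.

(* The $n$-dimensional Lebesgue measure on Borel sets, as an iterated product. *)
Fixpoint lebesgue_tuple n :
    {sigma_finite_measure set (n.-tuple RR) -> \bar R} :=
  match n with
  | 0 => \d_([tuple] : 0.-tuple RR)
  | n'.+1 => lebesgue_tuple_succ (lebesgue_tuple n')
  end.

Lemma lebesgue_tuple_box n (A : 'I_n -> set RR) :
    (forall i, measurable (A i)) ->
  lebesgue_tuple n [set t | forall i, A i (tnth t i)] =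
  (\prod_(i < n) lebesgue_measure (A i))%E.
Proof.
elim: n A => [A _|n IH A mA] /=.
  rewrite big_ord0 diracE mem_set//.
  by move=> [].
rewrite big_ord_recl -IH; last by move=> i; exact: mA.
rewrite /lebesgue_tuple_succ /pushforward.
rewrite -product_measure1E//.
- congr product_measure1; apply/seteqP; split => -[x t] /=.
  + move=> H; split => [|i]; first by have := H ord0; rewrite tnth0.
    by have := H (lift ord0 i); rewrite /tuple_cons/= tnthS.
  + move=> [H0 H] i; have [j ->|->] := unliftP ord0 i; last by rewrite tnth0.
    by rewrite /tuple_cons/= tnthS.
- rewrite (_ : [set _ | _] = \bigcap_(i in [set: 'I_n])
     ((@tnth _ RR)^~ i @^-1` A (lift ord0 i))); last first.
    by apply/seteqP; split => t /= H i; [move=> _|]; exact: H.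
  apply: fin_bigcap_measurable => // i _.
  rewrite -[X in measurable X]setTI.
  exact: measurable_tnth.
Qed.

End lebesgue_measure_tuple.

Section one_sided_calculus.
Context {R : realType}.
Implicit Types (A : set R) (f : R -> R) (x : R).

(* Difference quotients at x whose second point stays in A, so that at an end
   point of A these are the one-sided notions and values of f off A are
   irrelevant. *)
Definition derivable_within A f x : Prop :=
  cvg ((f y - f x) / (y - x) @[y --> within A x^']).

Definition derive_within A f x : R :=
  lim ((f y - f x) / (y - x) @[y --> within A x^']).

Definition class_C1_within A f : Prop :=
  (forall x, A x -> derivable_within A f x) /\
  {within A, continuous (derive_within A f)}.

(* To be used for open sets A, where the library's derivatives are the right
   ones. *)
Definition class_C_open (k : nat) A f : Prop :=
  (forall j x, (j < k)%N -> A x -> derivable (f^`(j)%classic) x 1) /\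
  {in A, continuous (f^`(k)%classic)}.

End one_sided_calculus.

(* $\mathbb{R}^{n+1}$ is represented as $\mathbb{R}^n \times \mathbb{R}$. *)
Section euclidean.
Context {R : realType} {n : nat}.
Notation Rn1 := (n.-tuple R * R)%type.

Definition enorm (z : n.-tuple R) : R := Num.sqrt (\sum_(i < n) tnth z i ^+ 2).

Definition edist (x y : Rn1) : R :=
  Num.sqrt (\sum_(i < n) (tnth x.1 i - tnth y.1 i) ^+ 2 + (x.2 - y.2) ^+ 2).

Definition eball (x : Rn1) (r : R) : set Rn1 := [set y | edist x y < r].

Definition origin : Rn1 := ([tuple of nseq n 0], 0).

Definition volume : set Rn1 -> \bar R :=
  (lebesgue_tuple n \x @lebesgue_measure R)%E.

Definition revolution_body (f : R -> R) : set Rn1 :=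
  [set p | f (enorm p.1) <= p.2].

End euclidean.
Arguments origin {R} n.

(* Main.v *)
Require Import Defs.
From mathcomp Require Import all_boot all_order all_algebra.
From mathcomp Require Import all_classical all_reals all_analysis.
From mathcomp Require Import measurable_realfun ring lra.
Set Implicit Arguments.
Unset Strict Implicit.
Unset Printing Implicit Defensive.
Import Order.TTheory GRing.Theory Num.Theory.
Import numFieldNormedType.Exports.
Local Open Scope classical_set_scope.
Local Open Scope ring_scope.

(* Since f' is concave on [0, oo) with f'(0) = 0, the ratio f'(s) / s is
   nonincreasing, so u |-> f (sqrt u) is concave and vanishes at 0, hence is
   subadditive; with the parallelogram law this yields
   f |a + z| + f |a - z| <= 2 (f |a| + f |z|).
   Write the volume of B((a, t), r) `&` C_f as the integral over z of the
   length of its vertical chord above a + z, and equally above a - z.  The chord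
   length is a truncated affine function of t - f |a +- z|, and the sum of these
   two heights is at least - 2 f |z| as t >= f |a|; pointwise in z, the two
   chords together are therefore at least twice as long as the chord of
   B(0, r) `&` C_f above z. *)

(** * Invariance of Lebesgue measure under translations and point reflections *)

Lemma lebesgue_measure_reflect (R : realType) (b : bool) (a : R)
    (A : set (measurableTypeR R)) : measurable A ->
  lebesgue_measure ((fun x => a + (-1) ^+ b * x) @^-1` A) = lebesgue_measure A.
Proof.
move=> mA.
have mf : measurable_fun setT
    ((fun x => a + (-1) ^+ b * x) : measurableTypeR R -> measurableTypeR R).
  by apply: measurable_funD => //; exact: measurable_funM.
apply/esym.
(* By uniqueness of Lebesgue measure it is enough to compare lengths on half-open intervals. A
   reflection moves the closed end to the other side, which leaves the length unchanged. *)
apply: (@lebesgue_measure_unique R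
  (measure_function_pushforward__canonical__measure_function_Measure
     lebesgue_measure mf)) => //= _ [[u v]] _ <-.
rewrite /pushforward /=.
have -> : (fun x : R => a + (-1) ^+ b * x) @^-1` `]u, v] =
    if b then `[a - v, a - u[%classic else `]u - a, v - a]%classic.
  by case: b mf => _; apply/seteqP; split=> x /=; rewrite !in_itv /=; lra.
by case: b {mf}; rewrite !lebesgue_measure_itv /= !lte_fin -!EFinB
  (ltrD2l, ltrD2r) ?ltrN2; case: ifP => // _; congr EFin; ring.
Qed.

Section tuple_map_preserving.
Context {R : realType}.
Notation RR := (measurableTypeR R).

Lemma measurable_mktuple n (phi : 'I_n -> RR -> RR) :
    (forall i, measurable_fun setT (phi i)) ->
  measurable_fun setT
    (fun z : n.-tuple RR => [tuple phi i (tnth z i) | i < n]).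
Proof.
move=> mphi; apply/measurable_fun_tnthP => i.
rewrite (_ : _ \o _ = phi i \o (fun z : n.-tuple RR => tnth z i)).
  by apply: measurableT_comp => //; exact: measurable_tnth.
by apply/funext => z /=; rewrite tnth_mktuple.
Qed.

(** Induction on the dimension: through [tuple_cons] the coordinatewise map becomes a product map
    [P]. The pushforward of the product measure under [P] agrees with that measure on rectangles,
    hence everywhere. *)
Lemma lebesgue_tuple_map_preserving n (phi : 'I_n -> RR -> RR) :
    (forall i, measurable_fun setT (phi i)) ->
    (forall i A, measurable A ->
      lebesgue_measure (phi i @^-1` A) = lebesgue_measure A) ->
  forall A, measurable A ->
  lebesgue_tuple n ((fun z => [tuple phi i (tnth z i) | i < n]) @^-1` A) =
  lebesgue_tuple n A.
Proof.
elim: n phi => [phi _ _ A _|n IH phi mphi phiE A mA].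
  by congr (lebesgue_tuple 0 _); apply/seteqP; split => z /=;
    rewrite (tuple0 [tuple of _]) (tuple0 z).
pose psi i := phi (lift ord0 i).
pose Psi (z : n.-tuple RR) := [tuple psi i (tnth z i) | i < n].
pose P (p : RR * n.-tuple RR) := (phi ord0 p.1, Psi p.2).
have mPsi : measurable_fun setT Psi by apply: measurable_mktuple => i; exact: mphi.
have mP : measurable_fun setT P.
  by apply: measurable_fun_pair; apply: measurableT_comp.
rewrite /= /lebesgue_tuple_succ /pushforward.
have mB : measurable (@tuple_cons R n @^-1` A).
  by rewrite -[X in measurable X]setTI; exact: measurable_tuple_cons.
rewrite [RHS](@product_measure_unique _ _ _ _ _ _ _
   (measure_function_pushforward__canonical__measure_function_Measure
     (lebesgue_measure \x lebesgue_tuple n)%E mP) _ _ mB).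
  rewrite /= /pushforward; congr (product_measure1 _ _ _).
  suff H p : [tuple phi i (tnth (tuple_cons p) i) | i < n.+1] = tuple_cons (P p).
    by apply/funext => p; rewrite /preimage /mkset H.
  case: p => x z; apply/eq_from_tnth => i; rewrite tnth_mktuple /tuple_cons /=.
  have [j ->|->] := unliftP ord0 i; last by rewrite !tnth0.
  by rewrite !tnthS tnth_mktuple.
move=> X Y mX mY; rewrite /= /pushforward.
rewrite (_ : P @^-1` _ = (phi ord0 @^-1` X) `*` (Psi @^-1` Y)) //.
rewrite product_measure1E; last 2 first.
- by rewrite -[X in measurable X]setTI; exact: mphi.
- by rewrite -[X in measurable X]setTI; exact: mPsi.
congr (_ * _)%E; first exact: phiE.
by apply: IH => // i *; [exact: mphi | exact: phiE].
Qed.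

End tuple_map_preserving.

(** * One-sided derivatives compared with ordinary ones *)

Section derive_within.
Context {R : realType}.
Implicit Types (A : set R) (f : R -> R) (x : R).

(** The substitution h = y - x, carried out along sequences, passes between the increment form of
    the derivative and the quotient used in [derive_within]. *)
Lemma derivable_cvg_slope f x : derivable f x 1 ->
  (f y - f x) / (y - x) @[y --> x^'] --> f^`()%classic x.
Proof.
move=> df; have dfx : h^-1 *: (f (h + x) - f x) @[h --> 0^'] --> f^`()%classic x.
  rewrite derive1E /derive; move: df; rewrite /derivable.
  rewrite (_ : (fun h : R => h^-1 *: ((f \o shift x) (h *: 1) - f x)) =
    (fun h => h^-1 *: (f (h + x) - f x))) //.
  by apply/funext => h /=; rewrite [h%:A]mulr1.
move/cvgr_dnbhsP: dfx => dfx; apply/cvgr_dnbhsP => u [ux cu].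
have /dfx : (forall n, u n - x != 0) /\ (u n - x @[n --> \oo] --> 0).
  split=> [n|]; first by rewrite subr_eq0.
  by rewrite -(subrr x); apply: cvgB => //; exact: cvg_cst.
apply: cvg_trans; apply: near_eq_cvg; apply: nearW => n /=.
by rewrite subrK [_ *: _]mulrC.
Qed.

Lemma derive_within_nbhs A f x : nbhs x A -> derivable f x 1 ->
  derive_within A f x = f^`()%classic x.
Proof.
move=> Ax df; rewrite /derive_within.
have -> : within A x^' = x^'.
  apply/seteqP; split => U; last exact: cvg_within.
  rewrite /within /= => AU; near=> y.
  by apply: (near AU y) => //; near: y; exact: nbhs_dnbhs.
exact: (cvg_lim (@norm_hausdorff _ _) (derivable_cvg_slope df)).
Unshelve. all: by end_near. Qed.

(** With q the difference quotient, f y = q y * (y - x) + f x off x; q converges and y - x tends to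
    0. *)
Lemma derivable_within_cvg A f x : derivable_within A f x ->
  f y @[y --> within A (nbhs x)] --> f x.
Proof.
move=> df; pose q y := (f y - f x) / (y - x).
have : q y * (y - x) + f x @[y --> within A x^'] -->
    lim (q y @[y --> within A x^']) * 0 + f x.
  apply: cvgD; last exact: cvg_cst.
  apply: cvgM => //; rewrite -(subrr x); apply: cvgB; last exact: cvg_cst.
  by move=> U xU; apply: cvg_within; exact: nbhs_dnbhs.
rewrite mulr0 add0r => cf U Ux.
have HU : \forall y \near x, y != x -> A y -> U (q y * (y - x) + f x) := cf U Ux.
apply: filterS HU => y HU Ay.
have [->|yx] := eqVneq y x; first exact: nbhs_singleton Ux.
by have := HU yx Ay; rewrite /q divfK ?subr_eq0 // subrK.
Qed.

End derive_within.

(** * The parallelogram inequality from a nonincreasing ratio g(s) / s *)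

Section parallelogram.
Context {R : realType}.
Variables f g : R -> R.
Hypothesis f0 : f 0 = 0.
Hypothesis cf : {within `[0, +oo[, continuous f}.
Hypothesis df : forall x : R, 0 < x -> is_derive x 1 f (g x).
Hypothesis g_ratio : forall s t, 0 < s -> s <= t -> s * g t <= t * g s.

(** In the variable u = x^2 this is the tangent line at m^2 lying above the concave function f(sqrt
    u). Up to a constant, [phi] is 2m times f minus the tangent parabola. By [g_ratio] its
    derivative is nonnegative before m and nonpositive after, so [phi] is largest at m. *)
Lemma tangent_parabola_ge m p : 0 < m -> 0 <= p ->
  2 * m * (f p - f m) <= g m * (p ^+ 2 - m ^+ 2).
Proof.
move=> m0 p0.
pose phi : R -> R := (2 * m) \*: (f : R -> R^o) - g m \*: ((id : R -> R) ^+ 2).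
have phiE x : phi x = 2 * m * f x - g m * x ^+ 2 by [].
pose dphi (x : R) := 2 * (m * g x - x * g m).
have dphiE (x : R) : 0 < x -> is_derive x 1 phi (dphi x).
  move=> x0; have dfx := df x0; apply: is_derive_eq.
  by rewrite /dphi /= expr1 /GRing.scale /=; ring.
have cphi (a b : R) : 0 <= a -> {within `[a, b], continuous phi}.
  move=> a0.
  have cfab : {within `[a, b], continuous f}.
    apply: continuous_subspaceW cf => x /=.
    by rewrite !in_itv /= andbT => /andP[ax _]; exact: le_trans ax.
  move=> x; apply: cvgB; first by apply: cvgZl_tmp; exact: cfab.
  apply: cvgZl_tmp; apply: continuous_subspaceT.
  exact: (@exprn_continuous R 2).
suff : phi p <= phi m by rewrite !phiE; lra.
have [pm|mp|-> //] := ltgtP p m.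
- have dpm (x : R) : x \in `]p, m[ -> is_derive x 1 phi (dphi x).
    by rewrite in_itv /= => /andP[px _]; apply: dphiE; exact: le_lt_trans px.
  have [c] := MVT pm dpm (cphi p m p0); rewrite in_itv /= => /andP[pc cm] E.
  have := g_ratio (le_lt_trans p0 pc) (ltW cm).
  by move=> h; rewrite -subr_ge0 E /dphi mulr_ge0 ?subr_ge0 ?(ltW pm) //; lra.
- have dmp (x : R) : x \in `]m, p[ -> is_derive x 1 phi (dphi x).
    by rewrite in_itv /= => /andP[mx _]; apply: dphiE; exact: lt_trans mx.
  have [c] := MVT mp dmp (cphi m p (ltW m0)); rewrite in_itv /= => /andP[mc cp] E.
  have := g_ratio m0 (ltW mc).
  by move=> h; rewrite -subr_le0 E /dphi mulr_le0_ge0 ?subr_ge0 ?(ltW mp) //; lra.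
Qed.

(** The quadratic mean m of p and q satisfies m^2 = a^2 + z^2. Concavity in the square of the
    variable gives f p + f q <= 2 f m, and subadditivity gives f m <= f a + f z. *)
Lemma parallelogram_le a z p q : 0 <= a -> 0 <= z -> 0 <= p -> 0 <= q ->
  p ^+ 2 + q ^+ 2 = 2 * (a ^+ 2 + z ^+ 2) -> f p + f q <= 2 * (f a + f z).
Proof.
wlog za : a z / z <= a.
  move=> W a0 z0 p0 q0 E; have [za|/ltW az] := leP z a; first exact: W.
  by rewrite [f a + _]addrC; apply: W => //; rewrite E addrC.
move=> a0 z0 p0 q0 E; pose m := Num.sqrt (a ^+ 2 + z ^+ 2).
have m2 : m ^+ 2 = a ^+ 2 + z ^+ 2 by rewrite sqr_sqrtr // addr_ge0 ?sqr_ge0.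
have m0 : 0 <= m by exact: sqrtr_ge0.
(* Tangent parabolas exist only at positive points. As z <= a, the case a = 0 forces z, p and q to
   vanish. *)
have [a_gt0|] := ltP 0 a; last first.
  move=> a_le0; have a_eq0 : a = 0 by lra.
  have z_eq0 : z = 0 by lra.
  move: E; rewrite a_eq0 z_eq0 expr0n /= addr0 mulr0 => /eqP.
  rewrite paddr_eq0 ?sqr_ge0 // !sqrf_eq0 => /andP[/eqP -> /eqP ->].
  by rewrite f0; lra.
have m_gt0 : 0 < m by rewrite /m sqrtr_gt0 ltr_wpDr ?sqr_ge0 ?exprn_gt0.
(* The tangent parabola at m is evaluated at p and q: since p^2 + q^2 = 2 m^2, its increments
   cancel. *)
have fpq : f p + f q <= 2 * f m.
  have := tangent_parabola_ge m_gt0 p0; have := tangent_parabola_ge m_gt0 q0.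
  have : g m * (p ^+ 2 - m ^+ 2) + g m * (q ^+ 2 - m ^+ 2) = 0.
    by rewrite -mulrDr m2; apply/eqP; rewrite mulf_eq0; apply/orP; right; apply/eqP; lra.
  move=> H1 H2 H3.
  have : 2 * m * (f p + f q - 2 * f m) <= 0 by lra.
  by rewrite pmulr_rle0 ?mulr_gt0 //; lra.
suff fm : f m <= f a + f z by lra.
have [z_gt0|] := ltP 0 z; last first.
  move=> z_le0; have -> : z = 0 by lra.
  have <- : m = a by rewrite /m (_ : z = 0) ?expr0n ?addr0 ?sqrtr_sqr ?ger0_norm //; lra.
  by rewrite f0 addr0.
(* Tangent parabola at z, evaluated at 0. *)
have fz : g z * z <= 2 * f z.
  have := tangent_parabola_ge z_gt0 (lexx 0); rewrite f0 => h.
  have : z * (g z * z - 2 * f z) <= 0 by lra.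
  by rewrite pmulr_rle0 //; lra.
(* Tangent parabola at a, evaluated at m: 2a (f m - f a) <= g a * z^2. The ratio inequality and [fz]
   bound the right side by a * g z * z <= 2a f z. *)
have fa := tangent_parabola_ge a_gt0 m0; rewrite m2 in fa.
have gaz := ler_wpM2r (ltW z_gt0) (g_ratio z_gt0 za).
have := ler_wpM2l (ltW a_gt0) fz => fz'.
have : 2 * a * (f m - f a - f z) <= 0 by lra.
by rewrite pmulr_rle0 ?mulr_gt0 //; lra.
Qed.

End parallelogram.

(** * Monotonicity of f'(s) / s from the sign of the third derivative *)

Lemma class_C_open_is_derive (R : realType) (k j : nat) (A : set R)
    (f : R -> R) (x : R) :
  class_C_open k A f -> (j < k)%N -> A x ->
  is_derive x 1 (f^`(j)%classic) (f^`(j.+1)%classic x).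
Proof.
by move=> [df _] jk Ax; apply: DeriveDef; [exact: df | rewrite -derive1E].
Qed.

Section slope_ratio.
Context {R : realType}.
Variable f : R -> R.
Hypothesis f_C1 : class_C1_within `[0, +oo[ f.
Hypothesis f'0 : derive_within `[0, +oo[ f 0 = 0.
Hypothesis f_C3 : class_C_open 3 `]0, +oo[ f.
Hypothesis f'''_le0 : forall s, 0 < s -> f^`(3)%classic s <= 0.

Let posE (x : R) : (`]0, +oo[%classic : set R) x = (0 < x) :> Prop.
Proof. by rewrite /= in_itv /= andbT. Qed.

Let df j (x : R) : (j < 3)%N -> 0 < x ->
  is_derive x 1 (f^`(j)%classic) (f^`(j.+1)%classic x).
Proof. by move=> j3 x0; apply: class_C_open_is_derive f_C3 j3 _; rewrite posE. Qed.

Lemma derive2_nincr (s t : R) : 0 < s -> s <= t ->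
  f^`(2)%classic t <= f^`(2)%classic s.
Proof.
move=> s0 st; have ht x : x \in `]s, t[ -> 0 < x.
  by rewrite in_itv /= => /andP[sx _]; exact: lt_trans sx.
apply: (@ler0_derive1_le_cc R _ s t) => //.
- by move=> x /ht x0; have [] := df (isT : (2 < 3)%N) x0.
- by move=> x /ht; exact: f'''_le0.
- apply: derivable_within_continuous => x; rewrite in_itv /= => /andP[sx _].
  by have [] := df (isT : (2 < 3)%N) (lt_le_trans s0 sx).
- by rewrite in_itv /= st lexx.
- by rewrite in_itv /= lexx st.
Qed.

(** As f'(0) = 0, the mean value theorem makes f'(s) / s a value of f'' on ]0,
    s[. It is at least the value of f'' on ]s, t[ that gives the slope of f' from s to t. *)
Lemma derive1_ratio_nincr (s t : R) : 0 < s -> s <= t ->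
  s * f^`()%classic t <= t * f^`()%classic s.
Proof.
move=> s0; rewrite le_eqVlt => /predU1P[->//|st].
(* The one-sided derivative is continuous up to 0, whereas the two-sided one at 0 would depend on f
   at negative arguments. *)
pose g := derive_within `[0, +oo[ f.
have gE (x : R) : 0 < x -> g x = f^`()%classic x.
  move=> x0; apply: derive_within_nbhs; last by have [] := df (isT : (0 < 3)%N) x0.
  apply: filterS (lt_nbhsr x0) => y y0.
  by rewrite /= in_itv /= andbT ltW.
have dg (x : R) : 0 < x -> is_derive x 1 g (f^`(2)%classic x).
  move=> x0; apply: near_eq_is_derive (df (isT : (1 < 3)%N) x0).
  by apply: filterS (lt_nbhsr x0) => y y0; rewrite gE.
have cg (a b : R) : 0 <= a -> {within `[a, b], continuous g}.
  move=> a0; apply: continuous_subspaceW (proj2 f_C1) => x /=.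
  by rewrite !in_itv /= andbT => /andP[ax _]; exact: le_trans ax.
have dg1 (x : R) : x \in `]0, s[ -> is_derive x 1 g (f^`(2)%classic x).
  by rewrite in_itv /= => /andP[x0 _]; exact: dg.
have dg2 (x : R) : x \in `]s, t[ -> is_derive x 1 g (f^`(2)%classic x).
  by rewrite in_itv /= => /andP[sx _]; apply: dg; exact: lt_trans sx.
have [c c_itv Es] := MVT s0 dg1 (cg 0 s (lexx 0)).
have [d d_itv Et] := MVT st dg2 (cg s t (ltW s0)).
move: c_itv d_itv; rewrite !in_itv /= => /andP[c0 cs] /andP[sd dt].
rewrite (gE _ s0) [g 0]f'0 !subr0 in Es.
rewrite (gE _ s0) (gE _ (lt_trans s0 st)) in Et.
have := derive2_nincr c0 (ltW (lt_trans cs sd)).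
rewrite -[f^`()%classic t](subrK (f^`()%classic s)) Et Es.
move: (f^`(2)%classic c) (f^`(2)%classic d) => C D DC.
(* Here f' s = C s and f' t = D (t - s) + C s. *)
rewrite -subr_ge0 (_ : _ - _ = (C - D) * (s * (t - s))); last by ring.
by rewrite mulr_ge0 ?mulr_ge0 ?subr_ge0 // ltW.
Qed.

Lemma class_C1_within_continuous : {within `[0, +oo[, continuous f}.
Proof.
apply/subspace_continuousP => x x0; apply: derivable_within_cvg.
exact: (proj1 f_C1).
Qed.

End slope_ratio.

(** * Length of a vertical chord of the ball above the graph *)

Section section_length.
Context {R : realType}.
Implicit Types (c r h s g F : R).

(** Here h is the half-length of the chord of the full ball and s the height of the centre above the
    graph. The graph may pass below the chord, cut it, or pass above it. *)
Definition chord_length h s := Num.max 0 (Num.min (2 * h) (h + s)).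

Lemma chord_length_ge0 h s : 0 <= chord_length h s.
Proof. by rewrite /chord_length le_max lexx. Qed.

(** If one of the chords on the right is the full 2h, it alone suffices, as F >= 0. Otherwise they
    are at least h + s1 and h + s2, whose sum is at least 2 (h - F). *)
Lemma chord_length_midpoint h F s1 s2 : 0 <= h -> 0 <= F -> - (2 * F) <= s1 + s2 ->
  chord_length h (- F) + chord_length h (- F) <= chord_length h s1 + chord_length h s2.
Proof.
rewrite /chord_length => h0 F0 s12.
case: (leP (2 * h) (h + s1)) => ?; case: (leP (2 * h) (h + s2)) => ?;
case: (leP (2 * h) (h - F)) => ?;
repeat match goal with |- context [Num.max 0 ?x] => case: (leP 0 x) => ? end; lra.
Qed.

Lemma lebesgue_measure_chord c r s g : 0 < r ->
  lebesgue_measure [set t : measurableTypeR R |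
     Num.sqrt (c + (s - t) ^+ 2) < r /\ g <= t] =
  (chord_length (Num.sqrt (r ^+ 2 - c)) (s - g))%:E.
Proof.
move=> r0; set h := Num.sqrt _.
have h0 : 0 <= h by exact: sqrtr_ge0.
have E t : (Num.sqrt (c + (s - t) ^+ 2) < r) = (s - h < t < s + h).
  rewrite -[in LHS](ger0_norm (ltW r0)) -sqrtr_sqr ltr_sqrt ?exprn_gt0 //.
  rewrite addrC -ltrBrDr.
  have [c_lt|c_ge] := ltP 0 (r ^+ 2 - c).
    rewrite -ltr_sqrt // sqrtr_sqr -/h ltr_norml.
    by apply/andP/andP => -[? ?]; split; lra.
  (* If r^2 <= c, the square root takes its default value 0, and ]s, s[ is empty, as is the section
     of the ball. *)
  have -> : h = 0 by exact: ler0_sqrtr.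
  rewrite subr0 addr0 ltNge (le_trans c_ge (sqr_ge0 _)) /=.
  by apply/esym/negP => /andP[]; lra.
have -> : [set t | Num.sqrt (c + (s - t) ^+ 2) < r /\ g <= t] =
    if s - h < g then `[g, s + h[%classic else `]s - h, s + h[%classic.
  by case: ltP => sg; apply/seteqP; split => t /=; rewrite E in_itv /=; lra.
rewrite /chord_length; case: (ltP (s - h) g) => sg;
  rewrite lebesgue_measure_itv /= lte_fin -EFinB.
  rewrite (_ : Num.min _ _ = h + (s - g)); last by apply/min_idPr; lra.
  case: ltP => gs; first by congr EFin; rewrite (max_idPr _); lra.
  by rewrite (max_idPl _) //; lra.
rewrite (_ : Num.min _ _ = 2 * h); last by apply/min_idPl; lra.
rewrite (max_idPr _); last by lra.
case: ltP => gs; first by congr EFin; lra.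
by congr EFin; lra.
Qed.

End section_length.

(** * The volume as an integral of chord lengths *)

Section volume_ball_body.
Context {R : realType} {n : nat}.
Notation RR := (measurableTypeR R).
Implicit Types (a z : n.-tuple R) (x : n.-tuple R * R) (f : R -> R).

(** This is a + z for [false] and a - z for [true], in one formula so that both signs share their
    lemmas. *)
Definition tuple_reflect (b : bool) a (z : n.-tuple RR) : n.-tuple RR :=
  [tuple tnth a i + (-1) ^+ b * tnth z i | i < n].

Lemma measurable_affine (b : bool) (c : R) :
  measurable_fun setT ((fun t => c + (-1) ^+ b * t) : RR -> RR).
Proof. by apply: measurable_funD => //; exact: measurable_funM. Qed.

Lemma measurable_tuple_reflect b a : measurable_fun setT (tuple_reflect b a).
Proof.
apply: (measurable_mktuple (phi := fun i (t : RR) => tnth a i + (-1) ^+ b * t)).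
by move=> i; exact: measurable_affine.
Qed.

Lemma ge0_integral_tuple_reflect b a (L : n.-tuple RR -> \bar R) :
    measurable_fun setT L -> (forall z, 0 <= L z)%E ->
  (\int[lebesgue_tuple n]_z L z =
   \int[lebesgue_tuple n]_z L (tuple_reflect b a z))%E.
Proof.
move=> mL L0.
have mT := measurable_tuple_reflect b a.
have := ge0_integral_pushforward mT (lebesgue_tuple n) measurableT mL (fun z _ => L0 z).
rewrite preimage_setT => <-; apply: eq_measure_integral => A mA _ /=.
apply/esym.
apply: (lebesgue_tuple_map_preserving
  (phi := fun i (t : RR) => tnth a i + (-1) ^+ b * t)) => // i.
  exact: measurable_affine.
by move=> B mB; exact: lebesgue_measure_reflect.
Qed.

Lemma measurable_enorm :
  measurable_fun setT (@enorm R n : n.-tuple RR -> RR).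
Proof.
change (measurable_fun setT ((Num.sqrt : RR -> RR) \o
  (fun z : n.-tuple RR => \sum_(i < n) tnth z i ^+ 2))).
apply: measurableT_comp.
  by apply: continuous_measurable_fun; exact: sqrt_continuous.
by apply: measurable_sum => i; apply: measurable_funX; exact: measurable_tnth.
Qed.

Lemma measurable_eball x (r : R) :
  measurable (eball x r : set (n.-tuple RR * RR)).
Proof.
have md : measurable_fun setT (Defs.edist x : n.-tuple RR * RR -> RR).
  change (measurable_fun setT ((Num.sqrt : RR -> RR) \o (fun y : n.-tuple RR * RR =>
    \sum_(i < n) (tnth x.1 i - tnth y.1 i) ^+ 2 + (x.2 - y.2) ^+ 2))).
  apply: measurableT_comp.
    by apply: continuous_measurable_fun; exact: sqrt_continuous.
  apply: measurable_funD.
    apply: measurable_sum => i; apply: measurable_funX; apply: measurable_funB => //.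
    exact: measurableT_comp (measurable_tnth i) measurable_fst.
  by apply: measurable_funX; apply: measurable_funB => //; exact: measurable_snd.
rewrite (_ : eball x r = Defs.edist x @^-1` `]-oo, r[).
  by rewrite -[X in measurable X]setTI; exact: md.
by apply/seteqP; split => y; rewrite /eball /= in_itv.
Qed.

Lemma measurable_revolution_body f : {within `[0, +oo[, continuous f} ->
  measurable (revolution_body f : set (n.-tuple RR * RR)).
Proof.
move=> cf.
have mf : measurable_fun setT ((fun p => p.2 - f (enorm p.1)) : n.-tuple RR * RR -> RR).
  apply: measurable_funB; first exact: measurable_snd.
  change (measurable_fun setT ((f : RR -> RR) \o
    (fun p : n.-tuple RR * RR => enorm p.1))).
  (* Continuity of f is known on [0, oo[ only, which contains the range of [enorm]. *)
  apply: (measurable_comp (F := (`[0, +oo[%classic : set RR))) => //.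
  - by move=> _ [p _ <-] /=; rewrite in_itv /= andbT; exact: sqrtr_ge0.
  - by apply: subspace_continuous_measurable_fun.
  - exact: measurableT_comp measurable_enorm measurable_fst.
rewrite (_ : revolution_body f =
    (fun p : n.-tuple RR * RR => p.2 - f (enorm p.1)) @^-1` `[0, +oo[).
  by rewrite -[X in measurable X]setTI; exact: mf.
by apply/seteqP; split => p; rewrite /revolution_body /= in_itv /= andbT subr_ge0.
Qed.

(** Both a + z and a - z lie at distance |z| from the centre, so the half-length does not depend on
    [b]; only the height of the graph does. *)
Lemma xsection_ball_body f x (r : R) b z : 0 < r ->
  lebesgue_measure
    (xsection (eball x r `&` revolution_body f) (tuple_reflect b x.1 z) : set RR) =
  (chord_length (Num.sqrt (r ^+ 2 - \sum_(i < n) tnth z i ^+ 2))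
    (x.2 - f (enorm (tuple_reflect b x.1 z))))%:E.
Proof.
move=> r0; rewrite xsectionE -lebesgue_measure_chord //.
congr (lebesgue_measure _); apply/funext => t.
rewrite /preimage /mkset /setI /eball /Defs.edist /revolution_body /=.
rewrite (eq_bigr (fun i => tnth z i ^+ 2)) // => i _.
by rewrite tnth_mktuple opprD addNKr sqrrN exprMn sqrr_sign mul1r.
Qed.

Section ball_body.
Variables (f : R -> R) (x : n.-tuple R * R) (r : R).
Hypothesis r_gt0 : 0 < r.
Hypothesis cf : {within `[0, +oo[, continuous f}.

Let mA : measurable (eball x r `&` revolution_body f : set (n.-tuple RR * RR)).
Proof.
by apply: measurableI; [exact: measurable_eball|exact: measurable_revolution_body].
Qed.

Let mxA : measurable_fun setT
  (lebesgue_measure \o xsection (eball x r `&` revolution_body f)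
    : n.-tuple RR -> \bar R).
Proof. exact: (measurable_fun_xsection lebesgue_measure mA). Qed.

Definition ball_body_chord b z : \bar R :=
  (chord_length (Num.sqrt (r ^+ 2 - \sum_(i < n) tnth z i ^+ 2))
    (x.2 - f (enorm (tuple_reflect b x.1 z))))%:E.

Lemma measurable_ball_body_chord b :
  measurable_fun setT (ball_body_chord b : n.-tuple RR -> \bar R).
Proof.
apply: eq_measurable_fun (measurableT_comp mxA (measurable_tuple_reflect b x.1)).
by move=> z _; rewrite /= xsection_ball_body.
Qed.

(** Fubini after the measure-preserving substitution; either sign yields the same volume, so the two
    integrals can be added. *)
Lemma volume_ball_body b :
  volume (eball x r `&` revolution_body f) =
  (\int[lebesgue_tuple n]_z ball_body_chord b z)%E.
Proof.
rewrite /volume /product_measure1 /= (ge0_integral_tuple_reflect b x.1) //=.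
by apply: eq_integral => z _; rewrite xsection_ball_body.
Qed.

End ball_body.

(** * Comparison of the ball at x with the ball at the origin *)

Lemma enorm_tuple_reflect_parallelogram a z :
  enorm (tuple_reflect false a z) ^+ 2 + enorm (tuple_reflect true a z) ^+ 2 =
  2 * (enorm a ^+ 2 + enorm z ^+ 2).
Proof.
rewrite /enorm !sqr_sqrtr ?sumr_ge0 // => [|i _|i _|i _|i _]; rewrite ?sqr_ge0 //.
rewrite -!big_split /= mulr_sumr; apply: eq_bigr => i _.
by rewrite !tnth_mktuple; ring.
Qed.

Lemma volume_ball_body_origin_le f x (r : R) : 0 < r ->
    {within `[0, +oo[, continuous f} -> (forall s, 0 <= s -> 0 <= f s) ->
    (forall a z p q : R, 0 <= a -> 0 <= z -> 0 <= p -> 0 <= q ->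
      p ^+ 2 + q ^+ 2 = 2 * (a ^+ 2 + z ^+ 2) -> f p + f q <= 2 * (f a + f z)) ->
    revolution_body f x ->
  (volume (eball (origin n) r `&` revolution_body f) <=
   volume (eball x r `&` revolution_body f))%E.
Proof.
move=> r0 cf f_ge0 fpar fx.
set V0 := volume _; set V := volume _.
(* The pointwise comparison concerns the two chords above a + z and a - z together, so both volumes
   are doubled. *)
suff : (V0 + V0 <= V + V)%E.
  have V0_ge0 : (0 <= V0)%E by exact: measure_ge0.
  have V_ge0 : (0 <= V)%E by exact: measure_ge0.
  move: V V0 V_ge0 V0_ge0 => [v| |] [w| |] //= _ _; rewrite -?EFinD ?lee_fin ?leey //.
  by lra.
have chord_ge0 y b z : (0 <= ball_body_chord f y r b z)%E.
  by rewrite lee_fin chord_length_ge0.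
(* The volume at the origin is expanded twice with the plus sign, the one at x once with each
   sign. *)
rewrite {1}/V0 (volume_ball_body _ r0 cf false) /V0 (volume_ball_body _ r0 cf false).
rewrite {1}/V (volume_ball_body _ r0 cf false) /V (volume_ball_body _ r0 cf true).
rewrite -!ge0_integralD //; try (by move=> z _; exact: chord_ge0);
  try exact: measurable_ball_body_chord.
apply: ge0_le_integral => //.
- by move=> z _; rewrite adde_ge0.
- by apply: emeasurable_funD; exact: measurable_ball_body_chord.
- by apply: emeasurable_funD; exact: measurable_ball_body_chord.
move=> z _; rewrite /ball_body_chord -!EFinD lee_fin.
have -> : tuple_reflect false (origin n).1 z = z.
  apply/eq_from_tnth => i.
  by rewrite tnth_mktuple tnth_nseq add0r expr0 mul1r.
rewrite sub0r; apply: chord_length_midpoint.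
- exact: sqrtr_ge0.
- by apply: f_ge0; exact: sqrtr_ge0.
(* With p = |a + z| and q = |a - z|, the height bound x.2 >= f |a| gives 2 x.2 - f p - f q >= - 2 f
   |z|. *)
have := fpar _ _ _ _ (sqrtr_ge0 _) (sqrtr_ge0 _) (sqrtr_ge0 _) (sqrtr_ge0 _)
  (enorm_tuple_reflect_parallelogram x.1 z).
by rewrite /revolution_body /= in fx; rewrite -!/(enorm _); lra.
Qed.

End volume_ball_body.

Theorem theorem7p10 (R : realType) (n : nat) (n_ge1 : (1 <= n)%N) (f : R -> R)
    (f_ge0 : forall s, 0 <= s -> 0 <= f s)
    (f_C1 : class_C1_within `[0, +oo[ f)
    (f0 : f 0 = 0)
    (f'0 : derive_within `[0, +oo[ f 0 = 0)
    (f_C3 : class_C_open 3 `]0, +oo[ f)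
    (f''_gt0 : forall s, 0 < s -> 0 < f^`(2)%classic s)
    (f'''_le0 : forall s, 0 < s -> f^`(3)%classic s <= 0)
    (f_superlinear : f s / s @[s --> +oo] --> +oo) :
  forall r : R, 0 < r ->
    volume (eball (origin n) r `&` revolution_body f) =
    ereal_inf [set volume (eball x r `&` revolution_body f) |
                x in @revolution_body R n f].
Proof.
move=> r r0; have cf := class_C1_within_continuous f_C1.
apply/eqP; rewrite eq_le; apply/andP; split; last first.
  (* The origin lies in the body because f 0 = 0, so its volume is among those of the infimum. *)
  apply: ereal_inf_lbound; exists (origin n) => //.
  rewrite /revolution_body /= (_ : enorm _ = 0) ?f0 //.
  rewrite /enorm big1 ?sqrtr0 // => i _.
  by rewrite tnth_nseq expr0n.
apply: le_ereal_inf_tmp => _ [x fx <-].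
apply: volume_ball_body_origin_le => // a z p q.
apply: (parallelogram_le (g := f^`()%classic)) => //.
- move=> s s0; apply: (class_C_open_is_derive (j := 0) f_C3) => //.
  by rewrite /= in_itv /= andbT.
- by move=> s t; exact: derive1_ratio_nincr.
Qed.
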